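(* For $n,d,r\in\mathbb N$ with $d\ge2$ and $r\le d-1$, there exists a line-rainbow $(n,d,r,1)$ Latin hypercube.
   Context: A $d$-dimensional hypercube of order $n$ is an array whose cells are indexed by $[n]^d$. An $\ell$-layer is the sub-array obtained by fixing $d-\ell$ coordinates and letting the other $\ell$ vary; a line is a $1$-layer. For $0\le t\le d-r$, an $(n,d,r,t)$ Latin hypercube is a $d$-dimensional hypercube of order $n$ with entries from a set of $n^r$ symbols such that every $(d-t)$-layer contains each symbol exactly $n^{d-r-t}$ times. It is line-rainbow if every line contains $n$ distinct symbols. *)

(* Defs.v *)
From mathcomp Require Import all_boot.

Set Implicit Arguments.
Unset Strict Implicit.
Unset Printing Implicit Defensive.

Definition cell (n d : nat) := {ffun 'I_d -> 'I_n}.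

Definition hypercube (n d : nat) (T : finType) := cell n d -> T.

(* F is the set of the d - l coordinates held fixed, at the values they take
   in c; the values of c outside F are irrelevant. *)
Definition is_layer (n d l : nat) (B : {set cell n d}) : Prop :=
  exists (F : {set 'I_d}) (c : cell n d),
    #|F| + l = d /\ B = [set x : cell n d | [forall i in F, x i == c i]].

(* The symbol set is the whole type T. *)
Definition latin_hypercube (n d r t : nat) (T : finType)
    (L : hypercube n d T) : Prop :=
  [/\ t + r <= d,
      #|T| = n ^ r
    & forall B : {set cell n d}, is_layer (d - t) B ->
      forall s : T, #|[set x in B | L x == s]| = n ^ (d - r - t)].

Definition line_rainbow (n d : nat) (T : finType)
    (L : hypercube n d T) : Prop :=
  forall B : {set cell n d}, is_layer 1 B -> #|L @: B| = n.

(* Main.v *)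
(** Identify symbols with Z_n^r and take the Z_n-linear map whose matrix is
    the identity block I_r followed by d - r >= 1 all-ones columns.  The
    columns other than any given one still generate Z_n^r, so the pair
    (x i, L x) is equidistributed for every coordinate i; and each column has
    an entry 1, so L is injective along lines. *)
Require Import Defs.
From mathcomp Require Import all_boot.
From mathcomp Require Import ssralg zmodp.

Set Implicit Arguments.
Unset Strict Implicit.
Unset Printing Implicit Defensive.

Import GRing.Theory.

(** Injections both ways between any two fibers force all fibers of [f] to have the same size, and
    the fibers over [V] partition [U]. *)
Lemma card_equal_fibers (U V : finType) (f : U -> V) (v : V) :
  (forall w w', exists2 g : U -> U,
     injective g & forall u, f u = w -> f (g u) = w') ->
  #|U| = #|V| * #|[set u | f u == v]|.
Proof.
move=> fib_inj.
have fib_le w w' : #|[set u | f u == w]| <= #|[set u | f u == w']|.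
  have [g g_inj fg] := fib_inj w w'.
  rewrite -(card_imset _ g_inj); apply/subset_leq_card/subsetP => _ /imsetP[u + ->].
  by rewrite !inE => /eqP fu; rewrite (fg _ fu).
rewrite -[#|U|]sum1_card (partition_big f predT) //= -sum_nat_const.
apply: eq_big => // w _; rewrite sum1_card -[LHS]cardsE.
by apply/eqP; rewrite eqn_leq !fib_le.
Qed.

Lemma card_line (n d : nat) (B : {set cell n d}) : is_layer 1 B ->
  #|B| = n /\
  exists j, {in B &, forall x y : cell n d, forall i, i != j -> x i = y i}.
Proof.
case=> F [c [cardF ->]].
have /cards1P[j Fc] : #|~: F| == 1.
  by rewrite -(eqn_add2l #|F|) cardsC card_ord cardF.
have inF i : (i \in F) = (i != j) by rewrite -[F]setCK Fc !inE.
split; last first.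
  exists j => x y; rewrite !inE => /forall_inP xc /forall_inP yc i.
  by rewrite -inF => iF; rewrite (eqP (xc i iF)) (eqP (yc i iF)).
(* [h] parametrizes the line by the value at its only free coordinate [j]. *)
pose h (a : 'I_n) : cell n d := [ffun i => if i == j then a else c i].
have h_inj : injective h by move=> a b /ffunP/(_ j); rewrite !ffunE eqxx.
rewrite -[RHS]card_ord -cardsT -(card_imset _ h_inj); apply: eq_card => x.
rewrite inE; apply/forall_inP/imsetP => [xc | [a _ ->] i].
  exists (x j); rewrite ?inE //; apply/ffunP => i; rewrite ffunE.
  by case: eqP => [-> // | /eqP]; rewrite -inF => /xc/eqP.
by rewrite inF ffunE => /negPf->.
Qed.

Section SumShift.

Variables (m r e : nat).
Local Notation Zn := 'I_m.+1.
Local Open Scope ring_scope.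

Definition sum_shift : hypercube m.+1 (r + e) {ffun 'I_r -> Zn} :=
  fun x => [ffun k => x (lshift e k) + \sum_(j < e) x (rshift r j)].

Lemma sum_shiftD (x y : {ffun 'I_(r + e) -> Zn}) :
  sum_shift (x + y) = sum_shift x + sum_shift y.
Proof.
apply/ffunP => k; rewrite !ffunE addrACA -big_split /=.
by congr (_ + _); apply: eq_bigr => j _; rewrite ffunE.
Qed.

Lemma sum_shift_surj_at (i : 'I_(r + e)) (a : Zn) (s : {ffun 'I_r -> Zn}) :
  (0 < e)%N -> exists2 x : cell m.+1 (r + e), x i = a & sum_shift x = s.
Proof.
move=> e_gt0.
(* Put [t] at position [j] of the last block and 0 elsewhere in it: the block sums to [t], which the
   first block compensates. The free parameter [t] is then tuned to give [x i = a]. *)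
suff witness (j : 'I_e) t : exists x : cell m.+1 (r + e),
    [/\ x (rshift r j) = t, forall k, x (lshift e k) = s k - t
      & sum_shift x = s].
  case: (split_ordP i) => k ->.
    (* For [i] in the first block, [t = s k - a] gives [x i = s k - t = a]; any position of the last
       block can hold [t]. *)
    have [x [_ xl Lx]] := witness (Ordinal e_gt0) (s k - a).
    by exists x => //; rewrite xl opprB addrC subrK.
  by have [x [xr _ Lx]] := witness k a; exists x.
pose x : cell m.+1 (r + e) := [ffun i => match split i with
  | inl k => s k - t | inr j' => if j' == j then t else 0 end].
have xl k : x (lshift e k) = s k - t.
  by rewrite ffunE -[lshift e k]/(unsplit (inl k)) unsplitK.
have xr j' : x (rshift r j') = if j' == j then t else 0.
  by rewrite ffunE -[rshift r j']/(unsplit (inr j')) unsplitK.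
exists x; split; rewrite ?xr ?eqxx //; apply/ffunP => k.
rewrite ffunE xl (eq_bigr _ (fun j' _ => xr j')) -big_mkcond big_pred1_eq.
by rewrite subrK.
Qed.

(** The map sending [x] to [(x i, sum_shift x)] is additive and onto, so translations carry each
    fiber into any other, and all fibers have size [n ^ (r + e) / n ^ (r + 1)] with [n = m.+1]. *)
Lemma card_sum_shift_fiber (i : 'I_(r + e)) (a : Zn) (s : {ffun 'I_r -> Zn}) :
  (0 < e)%N ->
  #|[set x : cell m.+1 (r + e) | (x i == a) && (sum_shift x == s)]|
    = (m.+1 ^ e.-1)%N.
Proof.
move=> e_gt0; pose f (x : cell m.+1 (r + e)) := (x i, sum_shift x).
have := @card_equal_fibers _ _ f (a, s); rewrite card_prod !card_ffun !card_ord.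
have -> : (m.+1 ^ (r + e) = m.+1 * m.+1 ^ r * m.+1 ^ e.-1)%N.
  by rewrite -expnS -expnD addSn -addnS prednK.
move=> card_f; apply/esym/eqP.
rewrite -(@eqn_pmul2l (m.+1 * m.+1 ^ r)) ?muln_gt0 ?expn_gt0 // card_f //.
move=> [a1 s1] [a2 s2].
have [z zi Lz] := sum_shift_surj_at i (a2 - a1) (s2 - s1) e_gt0.
exists (fun x : {ffun 'I_(r + e) -> Zn} => x + (z : {ffun _ -> Zn})).
  exact: addIr.
move=> x [xi Lx]; rewrite /f sum_shiftD ffunE zi Lz xi Lx.
by rewrite [a1 + _]addrC [s1 + _]addrC !subrK.
Qed.

(** Some component of the symbol involves coordinate [j] with coefficient 1: component [k] if [j] is
    the [k]-th of the first block, any component, such as the first, if [j] is in the last block.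
    Cancelling the other terms gives [x j = y j]. *)
Lemma sum_shift_inj_line (x y : cell m.+1 (r + e)) j : (0 < r)%N ->
  (forall i, i != j -> x i = y i) -> sum_shift x = sum_shift y -> x = y.
Proof.
move=> r_gt0 xy /ffunP Lxy; apply/ffunP => i.
have [->{i} | /xy //] := eqVneq i j.
case: (split_ordP j) => k def_j; move: xy; rewrite {}def_j => xy.
  move: (Lxy k); rewrite !ffunE (eq_bigr (fun l => y (rshift r l))).
    exact: addIr.
  by move=> l _; rewrite xy // eq_rlshift.
move: (Lxy (Ordinal r_gt0)); rewrite !ffunE xy ?eq_lrshift // => /addrI.
rewrite (bigD1 k) // [RHS](bigD1 k) //= (eq_bigr (fun l => y (rshift r l))).
  exact: addIr.
by move=> l lk; rewrite xy // eq_rshift.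
Qed.

End SumShift.

Theorem theorem5p3 (n d r : nat) (n_gt0 : 0 < n) (r_gt0 : 0 < r)
    (d_ge2 : 2 <= d) (r_le : r <= d - 1) :
  exists (T : finType) (L : hypercube n d T),
    latin_hypercube r 1 L /\ line_rainbow L.
Proof.
have d_gt0 : 0 < d by apply: leq_trans d_ge2.
have r_lt : r < d by rewrite -(subnK d_gt0) addn1 ltnS.
have [e e_gt0 def_d] : exists2 e, 0 < e & d = r + e.
  by exists (d - r); rewrite ?subn_gt0 // subnKC // ltnW.
move: n_gt0; case: n => // m _; subst d.
exists {ffun 'I_r -> 'I_m.+1}, (@sum_shift m r e); split.
  split; [by rewrite addnC leq_add2l | by rewrite card_ffun !card_ord |].
  move=> B [F [c [cardF ->]]] s.
  (* A layer of dimension [d - 1] fixes a single coordinate [i], so its cells with symbol [s] form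
     one of the fibers counted above. *)
  have /cards1P[i Fi] : #|F| == 1.
    by rewrite -(eqn_add2r (r + e - 1)) cardF subnKC.
  rewrite addKn subn1 -(card_sum_shift_fiber i (c i) s e_gt0).
  apply: eq_card => x; rewrite !inE Fi; congr (_ && _).
  by apply/forall_inP/idP => [-> | xc k]; rewrite ?inE // => /eqP->.
move=> B /card_line[cardB [j Bj]]; rewrite -[RHS]cardB.
apply: card_in_imset => x y xB yB; apply: sum_shift_inj_line => //.
exact: (Bj x y xB yB).
Qed.
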